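(* Let $G$ be a finite group with $\#G\ge2$ and $Y\subset G$ a non-empty subset. Then the following conditions are equivalent. (1) $Y$ is a pre-difference set, i.e., $\lambda_{[a]}/\#[a]$ is independent of the choice of $a\in G$, $a\neq1$. (2) $\lambda_{[a]}/\#[a]=((\#Y)^2-\#Y)/(\#G-1)$ for every $a\in G$, $a\ne1$, and $\lambda_{[1]}=\#Y$. (3) $\displaystyle\frac{\partial_\rho(Y)}{\dim\rho}=\sqrt{\frac{1/\#Y-1/\#G}{\#G-1}}$ for every $\rho\in\widehat{G}$, $\rho\neq1_G$, and $\partial_{1_G}(Y)=\sqrt{1/\#G}$. (4) $\partial_\rho(Y)/\dim\rho$ is independent of the choice of $\rho\in\widehat{G}\setminus\{1_G\}$. (5) Equality holds in the inequality $\displaystyle D(Y)\ge\sqrt{\frac{1/\#Y-1/\#G}{\#G-1}}$.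
   Context: For $a\in G$, $[a]\subset G$ denotes its conjugacy class, and $\lambda_{[a]}:=\#\{(x,y)\in Y\times Y\mid x^{-1}y\in[a]\}$. A non-empty subset $Y\subset G$ is a $(v,k,\lambda)$ pre-difference set if $v=\#G$, $k=\#Y$ and $\lambda_{[a]}=\lambda\,\#[a]$ for every $a\in G$ with $a\ne1$. $\widehat{G}$ is the set of isomorphism classes of irreducible complex representations of $G$; $\chi_\rho$ and $\dim\rho$ denote the character and dimension of $\rho\in\widehat G$; $1_G$ is the trivial representation. For $\rho\in\widehat{G}$, $$\partial_\rho(Y):=\sqrt{\frac{\dim\rho}{(\#Y)^2\,\#G}\sum_{x,y\in Y}\chi_\rho(x^{-1}y)},$$ where the quantity under the square root is a non-negative real number, and $D(Y):=\max_{\rho\in\widehat{G}\setminus\{1_G\}}\frac{\partial_\rho(Y)}{\dim\rho}$. *)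

(* Defs.v *)
From HB Require Import structures.
From mathcomp Require Import all_boot all_order all_algebra.
From mathcomp Require Import all_fingroup all_solvable all_field all_character.

Set Implicit Arguments.
Unset Strict Implicit.
Unset Printing Implicit Defensive.

Import Order.TTheory GRing.Theory Num.Theory GroupScope.

Local Open Scope ring_scope.

Section Defs.

Variables (gT : finGroupType) (G : {group gT}).

(* lambda_[a], where the conjugacy class [a] is taken in G. *)
Definition class_count (Y : {set gT}) (a : gT) : nat :=
  #|[set p in setX Y Y | (p.1^-1 * p.2)%g \in a ^: G]|.

Definition class_ratio (Y : {set gT}) (a : gT) : rat :=
  (class_count Y a)%:R / #|a ^: G|%:R.

(* lam is only assumed rational; for #|G| > 1 it is then automatically an      *)
(* integer, the sizes of the non-trivial classes having gcd 1.                 *)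
Definition pre_difference_params (v k : nat) (lam : rat) (Y : {set gT}) : Prop :=
  [/\ Y \subset G, Y != set0, v = #|G|, k = #|Y| &
      forall a, a \in G -> a != 1%g ->
        (class_count Y a)%:R = lam * #|a ^: G|%:R].

Definition pre_difference_set (Y : {set gT}) : Prop :=
  exists v k lam, pre_difference_params v k lam Y.

Lemma pre_difference_setP (Y : {set gT}) : Y \subset G -> Y != set0 ->
  pre_difference_set Y <->
  (forall a b, a \in G -> a != 1%g -> b \in G -> b != 1%g ->
     class_ratio Y a = class_ratio Y b).
Proof.
move=> sYG Yn0.
have nz a : #|a ^: G|%:R != 0 :> rat.
  by rewrite pnatr_eq0 -lt0n; apply/card_gt0P; exists a; apply: class_refl.
split=> [[v [k [lam [_ _ _ _ Hlam]]]] a b Ga a1 Gb b1 | Hc].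
  by rewrite /class_ratio !Hlam // !mulfK.
have [a /andP[Ga a1] | G1] := pickP [pred a in G | a != 1%g].
  exists #|G|, #|Y|, (class_ratio Y a); split=> // b Gb b1.
  by rewrite (Hc a b) // /class_ratio divfK.
exists #|G|, #|Y|, 0; split=> // b Gb b1.
by have := G1 b; rewrite /= Gb b1.
Qed.

(* Isomorphism classes of irreducible complex representations of G are indexed *)
(* by Iirr G: 'Chi_i is the representation, 'chi_i its character, and the      *)
(* trivial representation has index 0.                                         *)
Definition irr_dim (i : Iirr G) : nat := irr_degree (socle_of_Iirr i).

Definition deviation_sq (Y : {set gT}) (i : Iirr G) : algC :=
  (irr_dim i)%:R / (#|Y|%:R ^+ 2 * #|G|%:R)
    * \sum_(x in Y) \sum_(y in Y) 'chi_i (x^-1 * y)%g.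

(* The quantity written \partial_rho(Y). *)
Definition deviation (Y : {set gT}) (i : Iirr G) : algC :=
  sqrtC (deviation_sq Y i).

(* D(Y). The starting value 0 of the iterated maximum is harmless, and algC    *)
(* being only partially ordered is too: the ratios are non-negative reals (see *)
(* deviation_ge0) and, as #|G| > 1, there is a non-trivial representation; see *)
(* max_deviationP.                                                             *)
Definition max_deviation (Y : {set gT}) : algC :=
  \big[Num.max/0]_(i : Iirr G | i != 0) (deviation Y i / (irr_dim i)%:R).

Lemma deviation_sq_ge0 (Y : {set gT}) (i : Iirr G) :
  Y \subset G -> 0 <= deviation_sq Y i.
Proof.
move=> sYG; rewrite /deviation_sq; apply: mulr_ge0.
  by rewrite divr_ge0 ?ler0n // mulr_ge0 ?exprn_ge0 ?ler0n.
have chi1_gt0 := irr1_gt0 i.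
have G_gt0 : 0 < #|G|%:R :> algC by rewrite ltr0n cardG_gt0.
pose S z := \sum_(x in Y) 'chi_i (z * x)%g.
have -> : \sum_(x in Y) \sum_(y in Y) 'chi_i (x^-1 * y)%g =
    'chi_i 1%g * (#|G|%:R^-1 * \sum_(z in G) S z * (S z)^*).
  have -> : \sum_(z in G) S z * (S z)^* =
      \sum_(x in Y) \sum_(y in Y) \sum_(z in G)
         'chi_i (z * (x^-1 * y))%g * 'chi_i z^-1%g.
    rewrite (eq_bigr (fun z => \sum_(x in Y) \sum_(y in Y)
       'chi_i (z * y)%g * 'chi_i (z * x)^-1%g)) => [|z Gz].
      rewrite exchange_big; apply: eq_bigr => x Yx /=.
      rewrite exchange_big; apply: eq_bigr => y Yy /=.
      have Gx := subsetP sYG x Yx.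
      rewrite (reindex_inj (mulIg x^-1%g)) /=.
      apply: eq_big => [z | z Gz]; first by rewrite groupMr ?groupV.
      by rewrite mulgKV -mulgA.
    rewrite mulrC /S rmorph_sum mulr_suml; apply: eq_bigr => x Yx /=.
    rewrite mulr_sumr; apply: eq_bigr => y Yy; rewrite mulrC; congr (_ * _).
    by rewrite char_inv ?irr_char.
  rewrite !mulr_sumr; apply: eq_bigr => x Yx.
  rewrite !mulr_sumr; apply: eq_bigr => y Yy.
  by rewrite generalized_orthogonality_relation eqxx mul1r mulrC divfK ?gt_eqF.
apply: mulr_ge0; first exact: ltW.
apply: mulr_ge0; first by rewrite invr_ge0 ltW.
by apply: sumr_ge0 => z _; apply: mul_conjC_ge0.
Qed.

Lemma deviation_ge0 (Y : {set gT}) (i : Iirr G) :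
  Y \subset G -> 0 <= deviation Y i.
Proof. by move=> sYG; rewrite sqrtC_ge0 deviation_sq_ge0. Qed.

Lemma max_deviationP (Y : {set gT}) : Y \subset G -> (1 < #|G|)%N ->
  (forall i : Iirr G, i != 0 ->
     deviation Y i / (irr_dim i)%:R <= max_deviation Y) /\
  (exists2 i : Iirr G, i != 0 &
     max_deviation Y = deviation Y i / (irr_dim i)%:R).
Proof.
move=> sYG G_gt1; pose F (i : Iirr G) := deviation Y i / (irr_dim i)%:R.
have F0 i : 0 <= F i by rewrite divr_ge0 ?deviation_ge0 ?ler0n.
have [|i0 i0n0] := @has_nonprincipal_irr _ G; first by rewrite -cardG_gt1.
have [leM eqM] : (forall i : Iirr G, i != 0 -> F i <= max_deviation Y) /\
    (max_deviation Y = 0 \/ exists2 i : Iirr G, i != 0 & max_deviation Y = F i).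
  rewrite /max_deviation -/F.
  suff [leM eqM] : (forall i, i \in index_enum (Iirr G) -> i != 0 ->
        F i <= \big[Num.max/0]_(j : Iirr G | j != 0) F j) /\
      (\big[Num.max/0]_(j : Iirr G | j != 0) F j = 0 \/
       exists2 i : Iirr G, i != 0 & \big[Num.max/0]_(j : Iirr G | j != 0) F j = F i).
    by split=> // i; apply: leM; rewrite mem_index_enum.
  elim: (index_enum _) => [|i s [leM eqM]]; first by rewrite big_nil; split; last left.
  rewrite big_cons; case: ifP => [i_n0 | i_0]; last first.
    split=> // j; rewrite inE => /predU1P[-> | sj]; first by rewrite i_0.
    exact: leM.
  set m := bigop.body _ _ _ in leM eqM *.
  have m_real : m \is Num.real.
    by case: eqM => [-> | [j _ ->]]; rewrite ?rpred0 // ger0_real.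
  have [le_im | lt_mi] := real_leP (ger0_real (F0 i)) m_real; split=> //.
  - by move=> j; rewrite inE => /predU1P[-> // | sj]; apply: leM.
  - move=> j; rewrite inE => /predU1P[-> // | sj] j0.
    by rewrite (le_trans (leM j sj j0)) ?ltW.
  - by right; exists i.
split=> //; case: eqM => [M0 | //]; exists i0 => //.
by apply/le_anti; rewrite leM // M0 F0.
Qed.

End Defs.

(* Main.v *)
Require Import Defs.
From mathcomp Require Import all_boot all_order all_algebra.
From mathcomp Require Import all_fingroup all_solvable all_field all_character.
From mathcomp Require Import ring.
Import Order.TTheory GRing.Theory Num.Theory GroupScope.
Local Open Scope ring_scope.

(** The number of pairs in [Y] with quotient in the class of [a], divided by the
    size of that class, is a class function r of [a].  Up to normalisation, its
    Fourier coefficient at an irreducible character chi_i is the character sum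
      s_i = sum over x, y in Y of chi_i (x^-1 y),
    so Fourier inversion gives two formulas: [char_sum_class_ratio] writes s_i
    in terms of r, and [class_ratio_char_sum] writes r in terms of the s_i.
    Put t_i = s_i / chi_i 1 ([central_value]).  The normalised deviation is the
    square root of t_i / (k^2 v) with k = #|Y| and v = #|G|, so conditions (3),
    (4) and (5) are statements about the t_i.

    A class function is constant off 1 exactly when it is a combination of the
    trivial character and the regular character, that is, when its t_i agree
    for all i != 0.  This is the equivalence of (1) and (4).  The constants in
    (2) and (3) are then forced by two total counts: the values of r on G sum
    to k^2 ([sum_class_ratio]), and the t_i with i != 0, weighted by the squares
    of the degrees, sum to k (v - k) ([sum_central_value]).  The weights have
    sum v - 1, so the second identity says that k (v - k) / (v - 1) is the
    weighted mean of the t_i.  The maximum of the t_i is at least this mean,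
    with equality only if all of them are equal to it; this is (5). *)

(** * Fourier analysis of the difference count *)

Definition char_sum {gT : finGroupType} {G : {group gT}} (Y : {set gT})
    (i : Iirr G) : algC :=
  \sum_(x in Y) \sum_(y in Y) 'chi_i (x^-1 * y)%g.

(** By Schur's lemma the class average of the group-ring element
    [\sum_(x in Y) \sum_(y in Y) x^-1 * y] is central, and acts on the i-th
    irreducible representation as this scalar. *)
Definition central_value {gT : finGroupType} {G : {group gT}} (Y : {set gT})
    (i : Iirr G) : algC :=
  char_sum Y i / 'chi_i 1%g.

Section Fourier.

Set Implicit Arguments.
Unset Strict Implicit.

Variables (gT : finGroupType) (G : {group gT}) (Y : {set gT}).
Hypothesis sYG : Y \subset G.

Let nzG : #|G|%:R != 0 :> algC := neq0CG G.

Lemma char_sumE (i : Iirr G) :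
  char_sum Y i = 'chi_i 1%g * central_value Y i.
Proof. by rewrite mulrC divfK ?irr1_neq0. Qed.

Lemma char_sum0 : char_sum Y (0 : Iirr G) = #|Y|%:R ^+ 2.
Proof.
rewrite /char_sum (eq_bigr (fun _ => #|Y|%:R)) => [|x Yx].
  by rewrite sumr_const -[LHS]mulr_natr -expr2.
rewrite (eq_bigr (fun _ => 1)) ?sumr_const // => y Yy.
by rewrite irr0 cfun1E groupM ?groupV ?(subsetP sYG).
Qed.

Lemma central_value0 : central_value Y (0 : Iirr G) = #|Y|%:R ^+ 2.
Proof. by rewrite /central_value char_sum0 irr0 cfun11 divr1. Qed.

Lemma class_count1 : class_count G Y 1%g = #|Y|.
Proof.
rewrite /class_count class1G -[RHS](@card_imset _ _ (fun x => (x, x)));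
  last by move=> x y [].
apply: eq_card => -[x y]; rewrite !inE /= -eq_mulVg1.
apply/andP/imsetP => [[/andP[Yx _] /eqP <-]|[z Yz [-> ->]]]; first by exists x.
by rewrite Yz.
Qed.

Lemma class_ratio1 : class_ratio G Y 1%g = #|Y|%:R.
Proof. by rewrite /class_ratio class_count1 class1G cards1 divr1. Qed.

(** Swap the sums and apply the second orthogonality relation: the sum over i
    detects whether [x^-1 * y] is conjugate to [a], and the order of the
    centraliser of [a] is [#|G| / #|a ^: G|]. *)
Lemma class_ratio_char_sum (a : gT) : a \in G ->
  #|G|%:R * ratr (class_ratio G Y a)
    = \sum_(i : Iirr G) char_sum Y i * ('chi_i a)^*.
Proof.
move=> Ga; transitivity (#|'C_G[a]|%:R * (class_count G Y a)%:R : algC).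
  rewrite /class_ratio fmorph_div /= !ratr_nat.
  rewrite -(Lagrange (subcent1_sub a G)) index_cent1 natrM.
  have nz : #|a ^: G|%:R != 0 :> algC.
    by rewrite pnatr_eq0 -index_cent1 -lt0n indexg_gt0.
  by field.
under [RHS]eq_bigr => i _ do rewrite /char_sum mulr_suml.
rewrite exchange_big /=.
under [RHS]eq_bigr => x _ do
  (under eq_bigr => i _ do rewrite mulr_suml; rewrite exchange_big /=).
rewrite /class_count -sum1_card natr_sum mulr_sumr pair_big /=.
rewrite big_mkcond [RHS]big_mkcond /=; apply: eq_bigr => -[x y] _.
rewrite !inE /=; have [/andP[Yx Yy] /=|_ //] := boolP ((x \in Y) && (y \in Y)).
rewrite second_orthogonality_relation //.
case: ifP => [/imsetP[g Gg ->]|_ //].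
rewrite mulr1 mulr1n; congr (_%:R).
(* The two centralisers are conjugate under g. *)
by rewrite -conjg_set1 normJ -[X in X :&: _ :^ _](conjGid Gg) -conjIg cardJg.
Qed.

Lemma char_sum_class_ratio (i : Iirr G) :
  char_sum Y i = \sum_(a in G) ratr (class_ratio G Y a) * 'chi_i a.
Proof.
apply: (mulfI nzG); rewrite [RHS]mulr_sumr.
under [RHS]eq_bigr => a Ga do
  rewrite mulrA class_ratio_char_sum // mulr_suml.
rewrite exchange_big /=.
have orth (j : Iirr G) : \sum_(a in G) char_sum Y j * ('chi_j a)^* * 'chi_i a
    = char_sum Y j * (#|G|%:R * (i == j)%:R).
  rewrite -first_orthogonality_relation mulVKf // mulr_sumr.
  by apply: eq_bigr => a _; rewrite irr_inv; ring.
rewrite (eq_bigr _ (fun j _ => orth j)) (bigD1 i) //= big1 ?addr0 => [|j].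
  by rewrite eqxx mulr1 mulrC.
by rewrite eq_sym => /negPf->; rewrite !mulr0.
Qed.

(** Each pair in [Y] has exactly one quotient: this is [char_sum_class_ratio]
    for the trivial character. *)
Lemma sum_class_ratio :
  \sum_(a in G) ratr (class_ratio G Y a) = #|Y|%:R ^+ 2 :> algC.
Proof.
rewrite -char_sum0 char_sum_class_ratio; apply: eq_bigr => a Ga.
by rewrite irr0 cfun1E Ga mulr1.
Qed.

Lemma sum_irr_sq_nontrivial :
  \sum_(i : Iirr G | i != 0) 'chi_i 1%g ^+ 2 = #|G|%:R - 1 :> algC.
Proof.
by rewrite -(irr_sum_square G) [in RHS](bigD1 0) //= irr0 cfun11 expr1n; ring.
Qed.

(** [class_ratio_char_sum] at [a = 1], where the count of pairs is [#|Y|], after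
    moving the trivial character to the other side. *)
Lemma sum_central_value :
  \sum_(i : Iirr G | i != 0) 'chi_i 1%g ^+ 2 * central_value Y i
    = #|Y|%:R * (#|G|%:R - #|Y|%:R).
Proof.
have := class_ratio_char_sum (group1 G).
rewrite class_ratio1 ratr_nat (bigD1 0) //= char_sum0 irr0 cfun11 rmorph1.
under eq_bigr => i _ do rewrite char_sumE -irr_inv invg1 mulrAC -expr2.
by move=> e; apply: (addrI (#|Y|%:R ^+ 2 * 1)); rewrite -e; ring.
Qed.

(** * From the class ratios to the deviations and back *)

(** The mean of the central values at the non-trivial characters, weighted by
    the squares of the degrees: see [sum_central_value] for the numerator and
    [sum_irr_sq_nontrivial] for the denominator. *)
Definition mean_central_value : algC :=
  #|Y|%:R * (#|G|%:R - #|Y|%:R) / (#|G|%:R - 1).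

(** The class ratios equal [rho] off 1, so they are [rho] times the trivial
    character plus a multiple of the indicator of 1; only the latter pairs
    non-trivially with a non-trivial character. *)
Lemma central_value_const_ratio (rho : algC) (i : Iirr G) :
    (forall a, a \in G -> a != 1%g -> ratr (class_ratio G Y a) = rho) ->
  i != 0 -> central_value Y i = #|Y|%:R - rho.
Proof.
move=> ratioE i_n0; rewrite /central_value char_sum_class_ratio.
have sum0 : \sum_(a in G) 'chi_i a = 0.
  have /eqP := first_orthogonality_relation i 0.
  rewrite (negPf i_n0) mulf_eq0 invr_eq0 (negPf nzG) => /eqP sum0.
  rewrite -[RHS]sum0; apply: eq_bigr => a Ga.
  by rewrite irr0 cfun1E groupV Ga mulr1.
rewrite (bigD1 1%g) //= in sum0; rewrite (bigD1 1%g) //= class_ratio1 ratr_nat.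
under eq_bigr => a /andP[Ga a1] do rewrite ratioE //.
rewrite -mulr_sumr; move/eqP: sum0; rewrite addrC addr_eq0 => /eqP->.
by have nz := irr1_neq0 i; field.
Qed.

(** If all t_i with [i != 0] equal [t], the non-trivial part of the inversion
    formula is [t] times the regular character without its trivial
    constituent, and the regular character vanishes off 1. *)
Lemma class_ratio_const_central_value (t : algC) (a : gT) :
    (forall i : Iirr G, i != 0 -> central_value Y i = t) ->
    a \in G -> a != 1%g ->
  ratr (class_ratio G Y a) = (#|Y|%:R ^+ 2 - t) / #|G|%:R.
Proof.
move=> valE Ga a1; apply: (mulfI nzG); rewrite class_ratio_char_sum //.
have reg0 : \sum_(i : Iirr G) 'chi_i 1%g * ('chi_i a)^* = 0.
  rewrite second_orthogonality_relation //; case: imsetP => // -[g Gg].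
  by move/esym/eqP; rewrite conjg_eq1 (negPf a1).
rewrite (bigD1 0) //= irr0 cfun11 cfun1E Ga conjC1 mulr1 in reg0.
rewrite (bigD1 0) //= char_sum0 irr0 cfun1E Ga conjC1 mulr1.
rewrite (eq_bigr (fun i => t * ('chi_i 1%g * ('chi_i a)^*))) => [|i i_n0].
  rewrite -mulr_sumr; move/eqP: reg0; rewrite addrC addr_eq0 => /eqP->.
  by field.
by rewrite char_sumE valE //; ring.
Qed.

Hypothesis Yn0 : Y != set0.

Let nzY : #|Y|%:R != 0 :> algC.
Proof. by rewrite pnatr_eq0 cards_eq0. Qed.

Lemma irr_dimE (i : Iirr G) : (irr_dim i)%:R = 'chi_i 1%g :> algC.
Proof. by rewrite irr1_degree. Qed.

Lemma deviation_ratioE (i : Iirr G) :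
  deviation Y i / (irr_dim i)%:R
    = sqrtC (central_value Y i / (#|Y|%:R ^+ 2 * #|G|%:R)).
Proof.
have nz := irr1_neq0 i.
have d_ge0 : 0 <= deviation Y i / (irr_dim i)%:R.
  by rewrite divr_ge0 ?deviation_ge0.
rewrite -(sqrCK d_ge0) expr_div_n sqrtCK; congr (sqrtC _).
rewrite /deviation_sq irr_dimE /central_value -/(char_sum Y i).
by field; rewrite nz nzY nzG.
Qed.

Lemma central_value_ge0 (i : Iirr G) : 0 <= central_value Y i.
Proof.
have : 0 <= deviation_sq Y i * (#|Y|%:R ^+ 2 * #|G|%:R) / 'chi_i 1%g ^+ 2.
  apply: divr_ge0; last by rewrite exprn_ge0 // ltW ?irr1_gt0.
  by apply: mulr_ge0; rewrite ?deviation_sq_ge0 // mulr_ge0 ?exprn_ge0.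
congr (0 <= _); have nz := irr1_neq0 i.
rewrite /deviation_sq irr_dimE /central_value -/(char_sum Y i).
by field; rewrite nz nzY nzG.
Qed.

Hypothesis G_gt1 : (1 < #|G|)%N.

Let gt0G1 : 0 < #|G|%:R - 1 :> algC.
Proof. by rewrite subr_gt0 ltr1n. Qed.

Let nzG1 : #|G|%:R - 1 != 0 :> algC.
Proof. by rewrite gt_eqF. Qed.

Lemma mean_central_value_ge0 : 0 <= mean_central_value.
Proof.
apply: divr_ge0; last exact: ltW.
by rewrite mulr_ge0 // subr_ge0 ler_nat subset_leq_card.
Qed.

Lemma optimal_deviationE :
  (#|Y|%:R^-1 - #|G|%:R^-1) / (#|G|%:R - 1)
    = mean_central_value / (#|Y|%:R ^+ 2 * #|G|%:R) :> algC.
Proof. by rewrite /mean_central_value; field; rewrite nzY nzG nzG1. Qed.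

(** The weighted mean of the deficits [mean_central_value - central_value Y i]
    is zero, so they vanish as soon as none is negative. *)
Lemma central_value_eq_mean :
    (forall i : Iirr G, i != 0 -> central_value Y i <= mean_central_value) ->
  forall i : Iirr G, i != 0 -> central_value Y i = mean_central_value.
Proof.
move=> le_mean i i_n0; apply/esym/eqP; rewrite -subr_eq0.
pose F (j : Iirr G) : algC :=
  'chi_j 1%g ^+ 2 * (mean_central_value - central_value Y j).
have F_ge0 j : j != 0 -> 0 <= F j.
  move=> j_n0; rewrite mulr_ge0 ?subr_ge0 ?le_mean //.
  by rewrite exprn_ge0 // ltW ?irr1_gt0.
have sumF : \sum_(j : Iirr G | j != 0) F j = 0.
  under eq_bigr => j _ do rewrite /F mulrBr.
  rewrite sumrB -mulr_suml sum_irr_sq_nontrivial sum_central_value.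
  by rewrite /mean_central_value; field.
have /eqP := psumr_eq0P F_ge0 sumF i_n0.
by rewrite mulf_eq0 expf_eq0 /= (negPf (irr1_neq0 i)).
Qed.

Lemma central_value_const_eq_mean (t : algC) :
    (forall i : Iirr G, i != 0 -> central_value Y i = t) ->
  t = mean_central_value.
Proof.
move=> valE; apply: (canRL (mulfK nzG1)).
rewrite -sum_irr_sq_nontrivial -sum_central_value mulr_sumr.
by apply: eq_bigr => i i_n0; rewrite valE // mulrC.
Qed.

Lemma deviation_ratio_le (i : Iirr G) :
  (deviation Y i / (irr_dim i)%:R
     <= sqrtC ((#|Y|%:R^-1 - #|G|%:R^-1) / (#|G|%:R - 1)))
  = (central_value Y i <= mean_central_value).
Proof.
have c_gt0 : 0 < #|Y|%:R ^+ 2 * #|G|%:R :> algC.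
  by rewrite lt_def mulf_neq0 ?expf_neq0 // mulr_ge0 ?exprn_ge0.
rewrite deviation_ratioE optimal_deviationE ler_sqrtC ?nnegrE.
- by rewrite ler_pM2r // invr_gt0.
- by rewrite divr_ge0 ?central_value_ge0 // ltW.
- by rewrite divr_ge0 ?mean_central_value_ge0 // ltW.
Qed.

Lemma deviation_ratio_inj (i j : Iirr G) :
  deviation Y i / (irr_dim i)%:R = deviation Y j / (irr_dim j)%:R ->
  central_value Y i = central_value Y j.
Proof.
rewrite !deviation_ratioE => /sqrtC_inj; apply: mulIf.
by rewrite invr_eq0 mulf_neq0 ?expf_neq0.
Qed.

End Fourier.

(** * The equivalence *)

Theorem theorem3 (gT : finGroupType) (G : {group gT}) (Y : {set gT})
    (G_gt1 : (2 <= #|G|)%N) (sYG : Y \subset G) (Yn0 : Y != set0) :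
  [<-> (* (1) *)
       pre_difference_set G Y;
       (* (2) *)
       (forall a : gT, a \in G -> a != 1%g ->
          class_ratio G Y a = (#|Y|%:R ^+ 2 - #|Y|%:R) / (#|G|%:R - 1))
       /\ class_count G Y 1%g = #|Y|;
       (* (3) *)
       (forall i : Iirr G, i != 0 ->
          deviation Y i / (irr_dim i)%:R
            = sqrtC ((#|Y|%:R^-1 - #|G|%:R^-1) / (#|G|%:R - 1)))
       /\ deviation Y (0 : Iirr G) = sqrtC (#|G|%:R^-1);
       (* (4) *)
       forall i j : Iirr G, i != 0 -> j != 0 ->
         deviation Y i / (irr_dim i)%:R = deviation Y j / (irr_dim j)%:R;
       (* (5) *)
       max_deviation G Y
         = sqrtC ((#|Y|%:R^-1 - #|G|%:R^-1) / (#|G|%:R - 1))].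
Proof.
have nzY : #|Y|%:R != 0 :> algC by rewrite pnatr_eq0 cards_eq0.
have nzG : #|G|%:R != 0 :> algC := neq0CG G.
have nzG1 (F : numFieldType) : #|G|%:R - 1 != 0 :> F.
  by rewrite subr_eq0 pnatr_eq1 gtn_eqF.
have [max_ub [i0 i0_n0 max_i0]] := max_deviationP sYG G_gt1.
have lamE : ratr ((#|Y|%:R ^+ 2 - #|Y|%:R) / (#|G|%:R - 1))
    = (#|Y|%:R ^+ 2 - #|Y|%:R) / (#|G|%:R - 1) :> algC.
  by rewrite fmorph_div !rmorphB rmorphXn rmorph1 /= !ratr_nat.
have sum1_off1 : \sum_(a in G | a != 1%g) 1 = #|G|%:R - 1 :> algC.
  by rewrite -sumr_const [X in _ = X - _](bigD1 1%g) //= [RHS]addrC addKr.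
tfae.
- move/(pre_difference_setP sYG Yn0) => ratio_const.
  split=> [a Ga a1|]; last exact: class_count1.
  (* Sum the constant ratio over G minus 1, where the total is k^2 - k. *)
  apply: (@fmorph_inj _ _ (@ratr algC)); rewrite /= lamE.
  apply: (canRL (mulfK (nzG1 algC))).
  rewrite -sum1_off1 -(sum_class_ratio sYG) [in RHS](bigD1 1%g) //=.
  rewrite class_ratio1 // ratr_nat [RHS]addrC addKr mulr_sumr.
  apply: eq_bigr => b /andP[Gb b1]; rewrite mulr1.
  by rewrite (ratio_const a b).
- case=> ratioE _; split=> [i i_n0|].
    rewrite deviation_ratioE // optimal_deviationE //; congr (sqrtC (_ / _)).
    have ratioEC a : a \in G -> a != 1%g -> ratr (class_ratio G Y a)
        = (#|Y|%:R ^+ 2 - #|Y|%:R) / (#|G|%:R - 1) :> algC.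
      by move=> Ga a1; rewrite ratioE.
    rewrite (central_value_const_ratio ratioEC) //.
    by rewrite /mean_central_value; field; apply: nzG1.
  have dim0 : (irr_dim (0 : Iirr G))%:R = 1 :> algC.
    by rewrite irr_dimE irr0 cfun11.
  have := deviation_ratioE sYG Yn0 0; rewrite dim0 divr1 => ->.
  by rewrite central_value0 //; congr (sqrtC _); field; rewrite nzY nzG.
- by case=> devE _ i j i_n0 j_n0; rewrite !devE.
- move=> dev_const; rewrite max_i0 deviation_ratioE // optimal_deviationE //.
  congr (sqrtC (_ / _)); apply: central_value_const_eq_mean => // i i_n0.
  by apply: deviation_ratio_inj => //; apply: dev_const.
- move=> maxE; apply/(pre_difference_setP sYG Yn0) => a b Ga a1 Gb b1.
  have valE : forall i : Iirr G, i != 0 -> central_value Y i = mean_central_value G Y.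
    apply: central_value_eq_mean => // i i_n0.
    by rewrite -deviation_ratio_le // -maxE max_ub.
  apply: (@fmorph_inj _ _ (@ratr algC)).
  by rewrite /= !(class_ratio_const_central_value sYG valE).
Qed.
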